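(* For all integers $n,t,s$ with $n/2-t$ a nonnegative integer, $t\le n/2$ and $s\le n/2-t$, we have \[ \chi_F\left[K\left(n,\tfrac n2-t,s\right)\right]\ge \frac{1}{144}s^2. \]
   Context: $K(n,k,s)$ is the graph on $\binom{[n]}{k}$ in which two $k$-subsets of $[n]=\{1,\dots,n\}$ are adjacent iff they share fewer than $s$ elements. For $A\subseteq[n]$ with $|A|\ge s$, the Frankl set is $I_A=\{v\in\binom{[n]}{k}: |v\cap A|\ge (|A|+s)/2\}$, an independent set. The F-chromatic number $\chi_F[K(n,k,s)]$ is the minimum number of colors in a proper coloring in which every color class is contained in some Frankl set $I_A$.
   Formalization: The integers n, t, s are taken to be nonnegative; for negative t or s the inequality fails as written (e.g. n=14, t=-7, s=14 gives one vertex, so χ_F=1 < 196/144; and s=-13 gives χ_F ≤ 1 < 169/144). *)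

(* Defs.v *)
From mathcomp Require Import all_boot all_order all_algebra.

Set Implicit Arguments.
Unset Strict Implicit.
Unset Printing Implicit Defensive.

(* The ground set [n] is 'I_n; vertices of K(n,k,s) are its k-subsets. *)
Definition ksubset (n k : nat) := {v : {set 'I_n} | #|v| == k}.

Definition gen_kneser (n k s : nat) : rel (ksubset n k) :=
  fun u v => (u != v) && (#|val u :&: val v| < s).

(* #|v :&: A| >= (#|A| + s) / 2, with the exact (not the truncated) half. *)
Definition frankl_set (n k s : nat) (A : {set 'I_n}) : {set ksubset n k} :=
  [set v | #|A| + s <= 2 * #|val v :&: A|].

Definition is_frankl_set (n k s : nat) (F : {set ksubset n k}) : bool :=
  [exists A : {set 'I_n}, (s <= #|A|) && (F == frankl_set k s A)].

Definition proper_coloring (T C : finType) (e : rel T) (f : {ffun T -> C}) :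
    bool :=
  [forall u, forall v, e u v ==> (f u != f v)].

Definition color_class (T C : finType) (f : {ffun T -> C}) (c : C) : {set T} :=
  [set v | f v == c].

Definition F_colorable (n k s m : nat) : bool :=
  [exists f : {ffun ksubset n k -> 'I_m},
     proper_coloring (@gen_kneser n k s) f &&
     [forall c, exists F : {set ksubset n k},
        is_frankl_set s F && (color_class f c \subset F)]].

(* The color class of a vertex v in the injective coloring lies in the Frankl
   set of A = v as soon as s <= k. For s > k there is in general no coloring
   of this kind, which is why the F-chromatic number takes s <= k as an
   argument. *)
Lemma F_colorable_exists (n k s : nat) (le_sk : s <= k) :
  exists m, F_colorable n k s m.
Proof.
exists #|{: ksubset n k}|; apply/existsP.
exists [ffun v => enum_rank v]; apply/andP; split.
  apply/forallP=> u; apply/forallP=> v; apply/implyP=> /andP[neq_uv _].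
  by rewrite !ffunE (inj_eq enum_rank_inj).
apply/forallP=> c; set v := enum_val c.
apply/existsP; exists (frankl_set k s (val v)); apply/andP; split.
  by apply/existsP; exists (val v); rewrite (eqP (valP v)) le_sk eqxx.
apply/subsetP=> w; rewrite !inE ffunE => /eqP wc.
have -> : w = v by rewrite /v -wc enum_rankK.
by rewrite setIid (eqP (valP v)) mul2n -addnn leq_add2l.
Qed.

Definition F_chromatic_number (n k s : nat) (le_sk : s <= k) : nat :=
  ex_minn (F_colorable_exists n le_sk).

(* Main.v *)
Require Import Defs.
From mathcomp Require Import all_boot all_order all_algebra.
From mathcomp Require Import all_classical all_reals all_analysis.
From mathcomp Require Import Rstruct.
From mathcomp Require Import ring lra zify.

(** If the Frankl sets of [A_1, ..., A_m] cover all [k]-sets, where [k <= n/2],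
   then no [v] with [|v| >= n/2] satisfies [2 |v :&: A_i| - |A_i| < s] for all
   [i]. A one-sided form of Spencer's six standard deviations theorem gives a
   [v] with [2 |v :&: A_i| - |A_i| <= 9 sqrt m + 2], whence [s <= 12 sqrt m].

   The theorem is proved with a barrier potential. For [x] in the cube
   [[-1, 1]^n] with coordinate sum [0], let [w_i] be the distance from
   [sum_(j in A_i) x_j] up to a barrier that rises as the energy
   [sum_j (1 - x_j^2)] decreases, and keep [sum_i w_i^-2] below its initial
   bound. Take an [x] of least energy under this constraint, by compactness. If
   at least three coordinates were strictly inside the cube, a short step
   orthogonal to [x], to the all-ones vector and to the most dangerous sets,
   along a direction where the Hessian of the potential is at most average,
   would lower the energy: the second-order growth of the potential is less than
   what the rise of the barrier removes. So [x] has at most two coordinates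
   other than [1] and [-1], and rounding these costs at most [2]. *)

Set Implicit Arguments.
Unset Strict Implicit.
Unset Printing Implicit Defensive.
Import Order.TTheory GRing.Theory Num.Theory.
Import numFieldNormedType.Exports.
Local Open Scope ring_scope.

(** * Linear algebra: directions under linear constraints *)

(** Induction on [d]: [V] stacked on the rows found so far has rank below [n], so a nonzero vector
    is orthogonal to both, and it is normalized. *)
Lemma orthonormal_mx_exists (R : rcfType) (n c d : nat) (V : 'M[R]_(c, n)) :
  (c + d <= n)%N ->
  exists2 U : 'M[R]_(d, n), U *m U^T = 1%:M & V *m U^T = 0.
Proof.
elim: d => [|d IHd] le_cdn.
  by exists 0; apply/matrixP => i [].
have [|U UU VU] := IHd; first by rewrite (leq_trans _ le_cdn) ?leq_add2l.
have : kermx (col_mx V U)^T != 0.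
  rewrite -mxrank_eq0 mxrank_ker subn_eq0 -ltnNge.
  by rewrite (leq_ltn_trans (rank_leq_col _)) // -addnS.
case/rowV0Pn => u /sub_kermxP; rewrite tr_col_mx mul_mx_row => /eqP.
rewrite row_mx_eq0 => /andP[/eqP uV /eqP uU] u_neq0.
have uu_gt0 : 0 < (u *m u^T) 0 0.
  rewrite lt_def mxE; under eq_bigr do rewrite mxE -expr2.
  rewrite sumr_ge0 ?andbT => [|j _]; last exact: sqr_ge0.
  apply: contra_neq u_neq0 => /eqP.
  rewrite psumr_eq0 => [/allP u0|j _]; last exact: sqr_ge0.
  apply/rowP => j; rewrite mxE; apply/eqP.
  by rewrite -sqrf_eq0; apply: (implyP (u0 j (mem_index_enum _))).
pose a := (Num.sqrt ((u *m u^T) 0 0))^-1.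
suff [W WW VW] : exists2 W : 'M[R]_(1 + d, n), W *m W^T = 1%:M & V *m W^T = 0.
  by exists W.
exists (col_mx (a *: u) U).
  have Uu : U *m u^T = 0 by apply: trmx_inj; rewrite trmx_mul trmxK uU trmx0.
  rewrite tr_col_mx mul_col_row UU linearZ /= -!scalemxAr -!scalemxAl uU Uu.
  rewrite !scaler0 [u *m _]mx11_scalar !scale_scalar_mx mulrA -invfM -expr2.
  rewrite sqr_sqrtr ?ltW // mulVf -?scalar_mx_block //; exact: lt0r_neq0.
rewrite tr_col_mx mul_mx_row VU linearZ /= -scalemxAr.
have -> : V *m u^T = 0 by apply: trmx_inj; rewrite trmx_mul trmxK uV trmx0.
by rewrite scaler0 row_mx0.
Qed.

(** The difference of the two sides is the squared norm of [a] minus its projection to the row space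
    of [U]. *)
Lemma bessel (R : rcfType) (n d : nat) (U : 'M[R]_(d, n)) (a : 'rV[R]_n) :
  U *m U^T = 1%:M ->
  \sum_k (\sum_j a 0 j * U k j) ^+ 2 <= \sum_j a 0 j ^+ 2.
Proof.
move=> UU.
have sqE e (b : 'rV[R]_e) : \sum_j b 0 j ^+ 2 = (b *m b^T) 0 0.
  by rewrite mxE; apply: eq_bigr => j _; rewrite mxE.
pose p := a *m U^T.
have -> : \sum_k (\sum_j a 0 j * U k j) ^+ 2 = (p *m p^T) 0 0.
  rewrite -sqE; apply: eq_bigr => k _; rewrite mxE; congr (_ ^+ 2).
  by apply: eq_bigr => j _; rewrite mxE.
have : 0 <= \sum_j (a - p *m U) 0 j ^+ 2.
  by apply: sumr_ge0 => j _; exact: sqr_ge0.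
rewrite !sqE linearB /= trmx_mul mulmxBl !mulmxBr.
rewrite [p *m U *m (_ *m _)]mulmxA -[p *m U *m U^T]mulmxA UU mulmx1.
have -> : a *m (U^T *m p^T) = p *m p^T by rewrite mulmxA.
have -> : p *m U *m a^T = p *m p^T.
  by rewrite -mulmxA; congr (_ *m _); rewrite /p trmx_mul trmxK.
by rewrite subrr subr0 !mxE subr_ge0.
Qed.

(* The trace bounds the smallest eigenvalue of [sum_i q_i a_i a_i^T] on the
   orthogonal complement of the [v_i]. *)
Lemma small_quadratic_direction (R : rcfType) (n d : nat) (I J : finType)
    (v : I -> 'rV[R]_n) (q : J -> R) (a : J -> 'rV[R]_n) (N : R)
    (c : 'rV[R]_n) :
  (#|I| + d <= n)%N -> (0 < d)%N -> (forall i, 0 <= q i) ->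
  (forall i, \sum_j a i 0 j ^+ 2 <= N) ->
  exists u : 'rV[R]_n,
    [/\ \sum_j u 0 j ^+ 2 = 1, forall i, \sum_j v i 0 j * u 0 j = 0,
        \sum_j c 0 j * u 0 j <= 0 &
        d%:R * \sum_i q i * (\sum_j a i 0 j * u 0 j) ^+ 2 <= N * \sum_i q i].
Proof.
move=> le_Idn d_gt0 q_ge0 le_aN.
pose V := \matrix_(k < #|I|, j < n) v (enum_val k) 0 j.
have [U UU VU] := orthonormal_mx_exists V le_Idn.
pose S k := \sum_i q i * (\sum_j a i 0 j * U k j) ^+ 2.
(* Averaging: by Bessel the [S k] sum to at most the right-hand side, so the least of the [d] values
   satisfies the bound. *)
have [k leSN] : exists k, d%:R * S k <= N * \sum_i q i.
  apply/existsP/contraT; rewrite negb_exists => /forallP ltNS.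
  have : d%:R * \sum_k S k <= d%:R * (N * \sum_i q i).
    rewrite ler_wpM2l // exchange_big /= mulr_sumr ler_sum // => i _.
    rewrite -mulr_sumr mulrC ler_wpM2r //.
    by rewrite (le_trans (bessel (a i) UU)).
  rewrite leNgt => /negP[].
  have -> : d%:R * (N * \sum_i q i) = \sum_(k < d) N * \sum_i q i.
    by rewrite sumr_const card_ord mulr_natl.
  rewrite [ltRHS]mulr_sumr.
  apply: ltr_sum => [|k _]; last by rewrite ltNge ltNS.
  by apply/hasP; exists (Ordinal d_gt0); rewrite ?mem_index_enum.
have norm_u : \sum_j row k U 0 j ^+ 2 = 1.
  have -> : \sum_j row k U 0 j ^+ 2 = (U *m U^T) k k.
    by rewrite mxE; apply: eq_bigr => j _; rewrite !mxE expr2.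
  by rewrite UU mxE eqxx.
have vu i : \sum_j v i 0 j * row k U 0 j = 0.
  have -> : \sum_j v i 0 j * row k U 0 j = (V *m U^T) (enum_rank i) k.
    by rewrite mxE; apply: eq_bigr => j _; rewrite !mxE enum_rankK.
  by rewrite VU mxE.
have quad_u : d%:R * \sum_i q i * (\sum_j a i 0 j * row k U 0 j) ^+ 2 <=
    N * \sum_i q i.
  rewrite (le_trans _ leSN) // ler_wpM2l // ler_sum // => i _.
  by rewrite ler_wpM2l //; under eq_bigr do rewrite mxE.
have oppE (b : 'rV_n) :
    \sum_j b 0 j * (- row k U) 0 j = - \sum_j b 0 j * row k U 0 j.
  by rewrite -sumrN; apply: eq_bigr => j _; rewrite !mxE mulrN.
(* The other three conditions are invariant under a change of sign, which is therefore free to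
   settle the one on [c]. *)
have [cu_le0|cu_gt0] := leP (\sum_j c 0 j * row k U 0 j) 0.
  by exists (row k U).
exists (- row k U); split.
- by rewrite -norm_u; apply: eq_bigr => j _; rewrite !mxE sqrrN.
- by move=> i; rewrite oppE vu oppr0.
- by rewrite oppE oppr_le0 ltW.
- by under eq_bigr do rewrite oppE sqrrN.
Qed.

(** The coordinates outside [F], the vectors [x] and all-ones, and the sets in [T] give
    [n - #|F| + 2 + #|T|] linear constraints. This leaves [#|F| - (#|T| + 2)] dimensions to average
    over. *)
Lemma free_direction (R : rcfType) (m n : nat) (A : 'I_m -> {set 'I_n})
    (F : {set 'I_n}) (T : {set 'I_m}) (x c : 'rV[R]_n) (q : 'I_m -> R) :
  (#|T| + 2 < #|F|)%N -> (forall i, 0 <= q i) ->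
  exists u : 'rV[R]_n,
    [/\ \sum_j u 0 j ^+ 2 = 1 /\ (forall j, j \notin F -> u 0 j = 0),
        \sum_j u 0 j = 0 /\ \sum_j x 0 j * u 0 j = 0,
        forall i, i \in T -> \sum_(j in A i) u 0 j = 0,
        \sum_j c 0 j * u 0 j <= 0 &
        (#|F| - (#|T| + 2))%:R * \sum_i q i * (\sum_(j in A i) u 0 j) ^+ 2 <=
          #|F|%:R * \sum_i q i].
Proof.
move=> lt_TF q_ge0.
pose ind (B : {set 'I_n}) : 'rV[R]_n := \row_j (j \in B)%:R.
pose v (k : {j | j \in ~: F} + (bool + {i | i \in T})) : 'rV[R]_n :=
  match k with
  | inl j => ind [set val j]
  | inr (inl b) => if b then x else ind [set: 'I_n]
  | inr (inr i) => ind (A (val i))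
  end.
have indE B (u : 'rV[R]_n) : \sum_j ind B 0 j * u 0 j = \sum_(j in B) u 0 j.
  rewrite [RHS]big_mkcond; apply: eq_bigr => j _; rewrite mxE.
  by case: (j \in B); rewrite ?mul1r ?mul0r.
have card_le : (#|{: {j | j \in ~: F} + (bool + {i | i \in T})}| +
    (#|F| - (#|T| + 2)) <= n)%N.
  rewrite !card_sum card_bool !card_sig.
  have := cardsC F; rewrite card_ord.
  rewrite (eq_card (_ : [pred j | j \in ~: F] =i ~: F)) //.
  rewrite (eq_card (_ : [pred i | i \in T] =i T)) //.
  lia.
(* As [u] vanishes outside [F], each [A i] can be cut down to [F]; the norm bound is then [#|F|]
   instead of [n]. *)
have norm_ind i : \sum_j ind (A i :&: F) 0 j ^+ 2 <= #|F|%:R.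
  apply: (@le_trans _ _ (\sum_j ind F 0 j * (const_mx 1 : 'rV_n) 0 j)).
    apply: ler_sum => j _; rewrite !mxE inE mulr1.
    by case: (j \in F); case: (j \in A i); rewrite ?expr1n ?expr0n //= ler01.
  rewrite indE; under eq_bigr do rewrite mxE.
  by rewrite sumr_const.
have d_gt0 : (0 < #|F| - (#|T| + 2))%N by rewrite subn_gt0.
have [u [u1 vu cu qu]] :=
  small_quadratic_direction v c card_le d_gt0 q_ge0 norm_ind.
have supp_u j : j \notin F -> u 0 j = 0.
  rewrite -finset.in_setC => Fj; have := vu (inl (exist _ j Fj)).
  by rewrite /= indE big_set1.
exists u; split=> //.
- split; last exact: (vu (inr (inl true))).
  have := vu (inr (inl false)); rewrite /= indE => sum_u; rewrite -[RHS]sum_u.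
  by apply: eq_bigl => j; rewrite finset.in_setT.
- by move=> i Ti; have := vu (inr (inr (exist _ i Ti))); rewrite /= indE.
rewrite (le_trans _ qu) // ler_wpM2l // ler_sum // => i _.
rewrite ler_wpM2l // indE le_eqVlt; apply/orP; left; apply/eqP; congr (_ ^+ 2).
rewrite (big_setID F) /= [X in _ + X]big1 ?addr0 // => j.
by rewrite inE => /andP[/supp_u].
Qed.

(** * Analysis: second-order growth of the potential *)

Local Open Scope classical_set_scope.

(* Exact second-order expansion: with [h = e * (z - g * e)],
   [1/(w-h)^2 = 1/w^2 + 2h/w^3 + h^2 (3w-2h) / (w^3 (w-h)^2)]. *)
Lemma potential_step (R : realType) (J : finType) (w z : J -> R) (g : R) :
  (forall i, 0 < w i) -> \sum_i z i / w i ^+ 3 <= 0 ->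
  3 * \sum_i z i ^+ 2 / w i ^+ 4 < 2 * g * \sum_i (w i ^+ 3)^-1 ->
  \forall e \near (0 : R)^'+,
    (forall i, 0 < w i + g * e ^+ 2 - e * z i) /\
    \sum_i ((w i + g * e ^+ 2 - e * z i) ^+ 2)^-1 <= \sum_i (w i ^+ 2)^-1.
Proof.
move=> w_gt0 le_zw0 lt_zg.
pose h i (e : R) := z i - g * e.
pose k i (e : R) := w i - e * h i e.
pose Q i (e : R) :=
  h i e * h i e * (3 * w i - 2 * (e * h i e)) * (w i ^+ 3 * (k i e * k i e))^-1.
have e_cvg : e @[e --> (0 : R)] --> (0 : R) by exact: cvg_id.
have h_cvg i : h i e @[e --> (0 : R)] --> z i.
  rewrite -[X in _ --> X]subr0 -[X in _ - X](mulr0 g).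
  apply: cvgB; first exact: cvg_cst.
  by apply: cvgM => //; exact: cvg_cst.
have eh_cvg i : e * h i e @[e --> (0 : R)] --> (0 : R).
  by rewrite -[X in _ --> X](mul0r (z i)); exact: cvgM.
have k_cvg i : k i e @[e --> (0 : R)] --> w i.
  by rewrite -[X in _ --> X]subr0; apply: cvgB => //; exact: cvg_cst.
have Q_cvg i : Q i e @[e --> (0 : R)] --> 3 * (z i ^+ 2 / w i ^+ 4).
  have w_neq0 := lt0r_neq0 (w_gt0 i).
  have -> : 3 * (z i ^+ 2 / w i ^+ 4) =
      z i * z i * (3 * w i - 2 * 0) * (w i ^+ 3 * (w i * w i))^-1 by field.
  apply: cvgM.
    apply: cvgM; first exact: cvgM.
    apply: cvgB; first exact: cvg_cst.
    by apply: cvgM => //; exact: cvg_cst.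
  apply: cvgV; first by rewrite !mulf_neq0 // expf_neq0.
  apply: cvgM; first exact: cvg_cst.
  exact: cvgM.
have S_cvg : \sum_i Q i e @[e --> (0 : R)] --> \sum_i 3 * (z i ^+ 2 / w i ^+ 4).
  by apply: cvg_big => //; exact: add_continuous.
(* The second-order hypothesis is strict, so it passes from the limit to all small [e]. *)
have S_near : \forall e \near (0 : R)^'+,
    \sum_i Q i e < 2 * g * \sum_i (w i ^+ 3)^-1.
  apply: cvg_within; apply: (cvgr_lt _ S_cvg).
  by rewrite -mulr_sumr.
have k_near : \forall e \near (0 : R)^'+, forall i, 0 < k i e.
  apply: filter_forall => i; apply: cvg_within.
  exact: (cvgr_gt _ (k_cvg i) _ (w_gt0 i)).
near=> e.
have e_gt0 : 0 < e by near: e; exact: nbhs_right_gt.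
have kE i : w i + g * e ^+ 2 - e * z i = k i e by rewrite /k /h; ring.
have k_gt0 : forall i, 0 < k i e by near: e.
split=> [i|]; first by rewrite kE.
(* In the expansion, the [g] part of [2h/w^3] is of order [e^2] and joins the quadratic term. *)
have termE i : ((w i + g * e ^+ 2 - e * z i) ^+ 2)^-1 =
    (w i ^+ 2)^-1 + 2 * e * (z i / w i ^+ 3) +
    e ^+ 2 * (Q i e - 2 * g * (w i ^+ 3)^-1).
  have := lt0r_neq0 (k_gt0 i); have := lt0r_neq0 (w_gt0 i).
  by rewrite kE /Q /k /h => w_neq0 k_neq0; field; rewrite k_neq0 w_neq0.
rewrite (eq_bigr _ (fun i _ => termE i)) !big_split /= -!mulr_sumr big_split /=.
rewrite sumrN -mulr_sumr -addrA gerDl.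
have : \sum_i Q i e < 2 * g * \sum_i (w i ^+ 3)^-1 by near: e.
rewrite -subr_lt0 => lt_Qg; rewrite -[leRHS]addr0 lerD //.
  by rewrite mulr_ge0_le0 // mulr_ge0 // ltW.
by rewrite mulr_ge0_le0 ?sqr_ge0 // ltW.
Unshelve. all: by end_near. Qed.

(** * The barrier, the potential and compactness *)

Definition energy (R : realType) (n : nat) (x : 'rV[R]_n) : R :=
  \sum_j (1 - x 0 j ^+ 2).

(** The rise starts only below energy [m + 2], since with more than [m + 2] free coordinates all
    sets can be avoided at once. Its rate [9 / 4 / sqrt E] is tuned to the least slack,
    [9 / 4 * sqrt E], of the sets that are not avoided later. *)
Definition barrier (R : realType) (m : nat) (E : R) : R :=
  9 / 2 * (Num.sqrt m%:R + Num.max 0 (Num.sqrt (m + 2)%:R - Num.sqrt E)).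

Definition slack (R : realType) (m n : nat) (A : 'I_m -> {set 'I_n})
    (x : 'rV[R]_n) (i : 'I_m) : R :=
  barrier m (energy x) - \sum_(j in A i) x 0 j.

(* The truncation [Num.max 1] makes the potential continuous, so that the
   constraint is closed; it is inactive since [1 < 9 / 2 <= slack]. *)
Definition feasible (R : realType) (m n : nat) (A : 'I_m -> {set 'I_n})
    (x : 'rV[R]_n) : Prop :=
  [/\ forall j, x 0 j ^+ 2 <= 1, \sum_j x 0 j = 0 &
      \sum_i ((Num.max 1 (slack A x i)) ^+ 2)^-1 <= 4 / 81].

(** A single term of the potential is at most [4 / 81], so the truncated slack is at least [9 / 2].
    As this exceeds 1, the maximum is the slack itself. *)
Lemma slack_ge (R : realType) (m n : nat) (A : 'I_m -> {set 'I_n})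
    (x : 'rV[R]_n) (i : 'I_m) : feasible A x -> 9 / 2 <= slack A x i.
Proof.
move=> [_ _ Phi_le]; set w := slack A x.
have term_le : ((Num.max 1 (w i)) ^+ 2)^-1 <= 4 / 81.
  apply: le_trans Phi_le; rewrite (bigD1 i) //= lerDl sumr_ge0 // => k _.
  by rewrite invr_ge0 sqr_ge0.
have max_gt0 : 0 < Num.max 1 (w i) by rewrite lt_max ltr01.
have sqr_gt0 : 0 < (Num.max 1 (w i)) ^+ 2 by rewrite exprn_gt0.
rewrite -(ler_pM2r sqr_gt0) mulVf ?gt_eqF // in term_le.
by move: term_le max_gt0; rewrite /Num.max; case: ifP => _ *; nra.
Qed.

Lemma slack_ge_inv (R : realType) (m n : nat) (A : 'I_m -> {set 'I_n})
    (x : 'rV[R]_n) : feasible A x -> \sum_i (slack A x i ^+ 2)^-1 <= 4 / 81.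
Proof.
move=> Fx; have [_ _] := Fx; congr (_ <= _); apply: eq_bigr => i _.
by rewrite max_r // (le_trans _ (slack_ge i Fx)) //; lra.
Qed.

(** This is the source of the constant [4 / 81]: at the origin each slack is at least
    [9 / 2 * sqrt m], so each of the [m] terms is at most [4 / (81 m)]. *)
Lemma feasible0 (R : realType) (m n : nat) (A : 'I_m -> {set 'I_n}) :
  (0 < m)%N -> feasible A (0 : 'rV[R]_n).
Proof.
move=> m_gt0; split=> [j||]; first by rewrite mxE expr0n ler01.
  by rewrite big1 // => j _; rewrite mxE.
have m_gt0R : 0 < m%:R :> R by rewrite ltr0n.
have le_slack i : 9 / 2 * Num.sqrt m%:R <= slack A (0 : 'rV[R]_n) i.
  rewrite /slack /barrier big1 => [|j _]; last by rewrite mxE.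
  by rewrite subr0 ler_wpM2l ?lerDl ?le_max ?lexx //; lra.
apply: (@le_trans _ _ (\sum_(i < m) (81 / 4 * m%:R)^-1)); last first.
  rewrite sumr_const card_ord -[leLHS]mulr_natl.
  by rewrite le_eqVlt; apply/orP; left; apply/eqP; field; rewrite gt_eqF.
apply: ler_sum => i _; rewrite lef_pV2 ?posrE ?exprn_gt0 ?lt_max ?ltr01 //;
  last by apply: mulr_gt0 => //; lra.
have -> : 81 / 4 * m%:R = (9 / 2 * Num.sqrt m%:R) ^+ 2 :> R.
  by rewrite exprMn sqr_sqrtr ?ltW //; field.
have ge0 : 0 <= 9 / 2 * Num.sqrt m%:R :> R.
  by rewrite mulr_ge0 ?sqrtr_ge0 //; lra.
by rewrite ler_sqr ?nnegrE ?le_max ?ler01 ?le_slack ?orbT.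
Qed.

Lemma continuous_sum (R : realType) (T : topologicalType) (I : Type)
    (r : seq I) (P : pred I) (f : I -> T -> R) :
  (forall i, P i -> continuous (f i)) ->
  continuous (fun x => \sum_(i <- r | P i) f i x).
Proof.
move=> cf x; apply: cvg_big => [|i Pi]; first exact: add_continuous.
exact: cf.
Qed.

(* Over a concrete matrix space [cvgB] and [cvgM] unfold the neighbourhood
   filter, hence these versions over an abstract space. *)
Lemma continuous_subr (R : realType) (T : topologicalType) (f g : T -> R) :
  continuous f -> continuous g -> continuous (fun x => f x - g x).
Proof. by move=> cf cg x; apply: cvgB; [exact: cf | exact: cg]. Qed.

Lemma continuous_sqr (R : realType) (T : topologicalType) (f : T -> R) :
  continuous f -> continuous (fun x => f x ^+ 2).
Proof. by move=> cf x; apply: cvgM; exact: cf. Qed.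

Lemma continuous_maxr (R : realType) (T : topologicalType) (c : R)
    (f : T -> R) :
  continuous f -> continuous (fun x => Num.max c (f x)).
Proof.
move=> cf x; apply: (@continuous_max R _ (fun=> c)); last exact: cf.
exact: cvg_cst.
Qed.

Lemma continuous_inv_sqr_max1 (R : realType) (T : topologicalType)
    (f : T -> R) :
  continuous f -> continuous (fun x => ((Num.max 1 (f x)) ^+ 2)^-1).
Proof.
move=> cf.
move=> x; apply: cvgV; first by rewrite expf_neq0 // gt_eqF // lt_max ltr01.
exact: continuous_sqr (continuous_maxr cf) x.
Qed.

Lemma continuous_barrier (R : realType) (m : nat) : continuous (@barrier R m).
Proof.
have max_cont :
    continuous (fun E : R => Num.max 0 (Num.sqrt (m + 2)%:R - Num.sqrt E)).
  apply: continuous_maxr; apply: continuous_subr; first exact: cst_continuous.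
  exact: sqrt_continuous.
move=> E; apply: cvgM; first exact: cvg_cst.
by apply: cvgD; [exact: cvg_cst | exact: max_cont].
Qed.

Lemma continuous_energy (R : realType) (n : nat) : continuous (@energy R n).
Proof.
apply: continuous_sum => j _; apply: continuous_subr.
  exact: cst_continuous.
by apply: continuous_sqr; exact: coord_continuous.
Qed.

Lemma continuous_slack (R : realType) (m n : nat) (A : 'I_m -> {set 'I_n})
    (i : 'I_m) : continuous (fun x : 'rV[R]_n => slack A x i).
Proof.
apply: continuous_subr.
  move=> x; apply: continuous_comp; first exact: continuous_energy.
  exact: continuous_barrier.
by apply: continuous_sum => j _; exact: coord_continuous.
Qed.

Lemma feasible_compact (R : realType) (m n : nat) (A : 'I_m -> {set 'I_n}) :
  compact [set x : 'rV[R]_n | feasible A x].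
Proof.
apply: bounded_closed_compact.
  exists 1; split; first exact: num_real.
  move=> M M_gt1 x [x_le1 _ _].
  have M_ge0 : 0 <= M by lra.
  rewrite /Num.norm /= mx_normrE; apply/bigmax_leP; split=> // -[i j] _ /=.
  have := x_le1 j; rewrite (ord1 i) -[1](expr1n _ 2) -real_normK ?num_real //.
  by rewrite ler_sqr ?nnegrE // => /le_trans; apply; exact: ltW.
have -> : [set x : 'rV[R]_n | feasible A x] =
    \bigcap_j [set x : 'rV[R]_n | x 0 j ^+ 2 <= 1] `&`
    (((fun x : 'rV[R]_n => \sum_j x 0 j) @^-1` [set y | y = 0]) `&`
     ((fun x => \sum_i ((Num.max 1 (slack A x i)) ^+ 2)^-1) @^-1`
       [set y | y <= 4 / 81])).
  apply/seteqP; split=> x /=; first by case=> x_le1 ? ?; split=> // j _ /=.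
  by case=> x_le1 [? ?]; split=> // j; exact: (x_le1 j).
apply: closedI.
  apply: closed_bigI => j _.
  apply: (proj1 (continuous_closedP (fun x : 'rV[R]_n => x 0 j ^+ 2)) _
    [set y | y <= 1] (@closed_le _ _)).
  by apply: continuous_sqr; exact: coord_continuous.
apply: closedI.
  apply: (proj1 (continuous_closedP _) _ _ (@closed_eq _ _)).
  by apply: continuous_sum => j _; exact: coord_continuous.
apply: (proj1 (continuous_closedP _) _ _ (@closed_le _ _)).
apply: continuous_sum => i _; apply: continuous_inv_sqr_max1.
exact: continuous_slack.
Qed.

Lemma feasible_min_energy (R : realType) (m n : nat) (A : 'I_m -> {set 'I_n}) :
  (0 < m)%N ->
  exists2 x : 'rV[R]_n, feasible A x &
    forall y, feasible A y -> energy x <= energy y.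
Proof.
move=> m_gt0.
have [||x] := @EVT_min_rV R n (@energy R n) _ _ (@feasible_compact R m n A).
- by exists 0; exact: feasible0.
- by apply: continuous_subspaceT; exact: continuous_energy.
rewrite inE => Fx x_min; exists x => // y Fy.
by apply: x_min; rewrite inE.
Qed.

(** * Lowering the energy inside the feasible region *)

Definition free_coords (R : realType) (n : nat) (x : 'rV[R]_n) : {set 'I_n} :=
  [set j | x 0 j ^+ 2 < 1]%SET.

Lemma le_barrier (R : realType) (m : nat) (E1 E2 : R) :
  E1 <= E2 -> barrier m E2 <= barrier m E1.
Proof.
move=> le_E; apply: ler_wpM2l; first lra.
rewrite lerD2l.
have le_sqrt : Num.sqrt E1 <= Num.sqrt E2 by exact: ler_wsqrtr.
by rewrite ge_max !le_max lexx /= lerD2l lerN2 le_sqrt orbT.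
Qed.

(** Concavity of the square root: with [a] and [b] the old and new roots, [e ^+ 2 = (a - b) * (a +
    b) <= 2 * a * (a - b)]. *)
Lemma barrier_gain (R : realType) (m : nat) (E e : R) :
  0 < E -> E <= (m + 2)%:R -> e ^+ 2 <= E ->
  barrier m E + 9 / 4 / Num.sqrt E * e ^+ 2 <= barrier m (E - e ^+ 2).
Proof.
move=> E_gt0 le_E le_e; set a := Num.sqrt E; set b := Num.sqrt (E - e ^+ 2).
have a_gt0 : 0 < a by rewrite sqrtr_gt0.
have b_ge0 : 0 <= b by exact: sqrtr_ge0.
have sqr_a : a ^+ 2 = E by rewrite sqr_sqrtr // ltW.
have sqr_b : b ^+ 2 = E - e ^+ 2 by rewrite sqr_sqrtr // subr_ge0.
have le_ba : b <= a by apply: ler_wsqrtr; rewrite gerBl sqr_ge0.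
have le_aM : a <= Num.sqrt (m + 2)%:R by exact: ler_wsqrtr.
rewrite /barrier -/a -/b !max_r ?subr_ge0 //; last exact: le_trans le_aM.
have -> : e ^+ 2 = (a - b) * (a + b) by rewrite -subr_sqr sqr_a sqr_b; ring.
suff : 9 / 4 / a * ((a - b) * (a + b)) <= 9 / 2 * (a - b) by lra.
have -> : 9 / 2 * (a - b) = 9 / 4 / a * ((a - b) * (2 * a)).
  by field; rewrite gt_eqF.
apply: ler_wpM2l; first by rewrite divr_ge0 ?ltW //; lra.
by apply: ler_wpM2l; lra.
Qed.

Lemma near_cube (R : realType) (n : nat) (x u : 'rV[R]_n) :
  (forall j, x 0 j ^+ 2 <= 1) -> (forall j, 1 <= x 0 j ^+ 2 -> u 0 j = 0) ->
  \forall e \near (0 : R)^'+, forall j, (x + e *: u) 0 j ^+ 2 <= 1.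
Proof.
move=> x_le1 u0; apply: filter_forall => j.
have [lt_x1|/u0 uj0] := ltP (x 0 j ^+ 2) 1; last first.
  by apply: nearW => e; rewrite !mxE uj0 mulr0 addr0.
have cvg_j : x 0 j + e * u 0 j @[e --> (0 : R)] --> x 0 j.
  rewrite -[X in _ --> X]addr0 -[X in _ + X](mul0r (u 0 j)).
  apply: cvgD; first exact: cvg_cst.
  by apply: cvgM; [exact: cvg_id | exact: cvg_cst].
have cvg_sqr : (x 0 j + e * u 0 j) * (x 0 j + e * u 0 j) @[e --> (0 : R)]
    --> x 0 j * x 0 j by exact: cvgM.
rewrite expr2 in lt_x1.
have : \forall e \near (0 : R)^'+,
    (x 0 j + e * u 0 j) * (x 0 j + e * u 0 j) < 1.
  by apply: cvg_within; exact: (cvgr_lt _ cvg_sqr).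
by apply: filterS => e; rewrite !mxE expr2 => /ltW.
Qed.

Lemma energy_step (R : realType) (n : nat) (x u : 'rV[R]_n) (e : R) :
  \sum_j u 0 j ^+ 2 = 1 -> \sum_j x 0 j * u 0 j = 0 ->
  energy (x + e *: u) = energy x - e ^+ 2.
Proof.
move=> u1 xu0; have -> : e ^+ 2 = 2 * e * (\sum_j x 0 j * u 0 j) +
    e ^+ 2 * \sum_j u 0 j ^+ 2 by rewrite u1 xu0; ring.
rewrite !mulr_sumr -big_split -sumrB; apply: eq_bigr => j _ /=.
by rewrite !mxE; ring.
Qed.

Lemma energy_le_free (R : realType) (n : nat) (x : 'rV[R]_n) :
  (forall j, x 0 j ^+ 2 <= 1) ->
  energy x <= #|free_coords x|%:R.
Proof.
move=> x_le1; rewrite -sum1_card natr_sum [leRHS]big_mkcond /=.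
apply: ler_sum => j _; rewrite inE.
by case: ltP => [_|]; have := sqr_ge0 (x 0 j); lra.
Qed.

(** Common frame of both descent cases. Lower bounds [w] on the new slacks suffice, because
    [barrier_gain] only bounds the barrier from below; the premise on the energy supplies its
    condition [e ^+ 2 <= E]. *)
Lemma feasible_step (R : realType) (m n : nat) (A : 'I_m -> {set 'I_n})
    (x u : 'rV[R]_n) :
  feasible A x -> \sum_j u 0 j ^+ 2 = 1 -> \sum_j u 0 j = 0 ->
  \sum_j x 0 j * u 0 j = 0 -> (forall j, 1 <= x 0 j ^+ 2 -> u 0 j = 0) ->
  (\forall e \near (0 : R)^'+, 0 <= energy (x + e *: u) ->
     exists2 w : 'I_m -> R, forall i, 0 < w i <= slack A (x + e *: u) i &
       \sum_i ((w i) ^+ 2)^-1 <= \sum_i (slack A x i ^+ 2)^-1) ->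
  exists2 y, feasible A y & energy y < energy x.
Proof.
move=> Fx u1 u0 xu0 supp_u step.
have [x_le1 sum_x _] := Fx.
suff : \forall e \near (0 : R)^'+,
    feasible A (x + e *: u) /\ energy (x + e *: u) < energy x.
  by move=> /filter_ex[e [? ?]]; exists (x + e *: u).
near=> e.
have e_gt0 : 0 < e by near: e; exact: nbhs_right_gt.
have y_le1 : forall j, (x + e *: u) 0 j ^+ 2 <= 1.
  by near: e; exact: near_cube.
rewrite (energy_step _ u1 xu0) ltrBlDr ltrDl exprn_gt0 //.
split=> //; split=> //.
  under eq_bigr do rewrite !mxE.
  by rewrite big_split /= -mulr_sumr sum_x u0 mulr0 addr0.
have [||w w_slack le_w] := (near step e) _.
- by [].
- by apply: sumr_ge0 => j _; rewrite subr_ge0.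
apply: le_trans (slack_ge_inv Fx); apply: le_trans le_w.
apply: ler_sum => i _; have /andP[w_gt0 le_wi] := w_slack i.
rewrite lef_pV2 ?posrE ?exprn_gt0 ?lt_max ?ltr01 //.
by apply: lerXn2r; rewrite ?nnegrE ?le_max ?ler01 ?le_wi ?orbT // ltW.
Unshelve. all: by end_near. Qed.

(** There is room to be orthogonal to every set: the set sums stay fixed while the barrier does not
    fall. *)
Lemma energy_descent_many (R : realType) (m n : nat) (A : 'I_m -> {set 'I_n})
    (x : 'rV[R]_n) :
  feasible A x -> (m + 2 < #|free_coords x|)%N ->
  exists2 y, feasible A y & energy y < energy x.
Proof.
move=> Fx; set F := free_coords x => lt_mF.
have [x_le1 sum_x _] := Fx.
have lt_TF : (#|[set: 'I_m]%SET| + 2 < #|F|)%N by rewrite cardsT card_ord.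
have [u [[u1 supp_u] [u0 xu0] Tu _ _]] :=
  free_direction A x 0 lt_TF (fun i : 'I_m => lexx (0 : R)).
apply: (feasible_step Fx u1 u0 xu0).
  by move=> j x_ge1; apply: supp_u; rewrite inE -leNgt.
apply: nearW => e _; exists (slack A x) => // i.
rewrite (lt_le_trans _ (slack_ge i Fx)) /=; last lra.
rewrite /slack (energy_step _ u1 xu0).
have -> : \sum_(j in A i) (x + e *: u) 0 j = \sum_(j in A i) x 0 j.
  under eq_bigr do rewrite !mxE.
  by rewrite big_split /= -mulr_sumr Tu ?mulr0 ?addr0 // inE.
by rewrite lerD2r le_barrier // gerBl sqr_ge0.
Qed.

(* The direction [u] avoids the sets with the smallest slacks, of which there
   are at most a quarter of the free coordinates. For all others the slack is
   at least of order [sqrt (energy x)], so that on average over the remaining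
   orthonormal directions the second-order growth of the potential is less
   than what the growth of the barrier takes away. *)
Lemma energy_descent_few (R : realType) (m n : nat) (A : 'I_m -> {set 'I_n})
    (x : 'rV[R]_n) :
  (0 < m)%N -> feasible A x -> (2 < #|free_coords x| <= m + 2)%N ->
  exists2 y, feasible A y & energy y < energy x.
Proof.
move=> m_gt0 Fx; set F := free_coords x => /andP[F_gt2 F_le].
have [x_le1 sum_x _] := Fx.
set w := slack A x.
have w_gt0 i : 0 < w i by apply: lt_le_trans (slack_ge i Fx); lra.
have Phi_le : \sum_i (w i ^+ 2)^-1 <= 4 / 81 := slack_ge_inv Fx.
have F_gt0 : 0 < #|F|%:R :> R by rewrite ltr0n; lia.
have E_le : energy x <= #|F|%:R := energy_le_free x_le1.
have E_gt0 : 0 < energy x.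
  have /card_gt0P[j0] : (0 < #|F|)%N by lia.
  rewrite inE => xj0; rewrite /energy (bigD1 j0) //=.
  by apply: ltr_pwDl; [lra | apply: sumr_ge0 => j _; rewrite subr_ge0].
set a := Num.sqrt (energy x).
have a_gt0 : 0 < a by rewrite sqrtr_gt0.
have sqr_a : a ^+ 2 = energy x by rewrite sqr_sqrtr // ltW.
(* Markov threshold: four times the total [4 / 81] divided by [#|F|], so [T] has fewer than
   [#|F| / 4] elements. *)
pose T := [set i | 16 / 81 / #|F|%:R < (w i ^+ 2)^-1]%SET.
have T_lt : (4 * #|T| < #|F|)%N.
  have [->|/card_gt0P[i0 Ti0]] := posnP #|T|; first by lia.
  have : #|T|%:R * (16 / 81 / #|F|%:R) < 4 / 81 :> R.
    apply: lt_le_trans Phi_le; rewrite mulr_natl -sumr_const.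
    rewrite [ltRHS](bigID (mem T)) /=.
    apply: ltr_wpDr; first by apply: sumr_ge0 => i _; rewrite invr_ge0 sqr_ge0.
    rewrite (bigD1 i0) //= [ltRHS](bigD1 i0) //=.
    apply: ltr_leD; first by move: Ti0; rewrite inE.
    by apply: ler_sum => i /andP[]; rewrite inE => /ltW.
  rewrite mulrA ltr_pdivrMr // => lt_TF.
  by rewrite -(ltr_nat R) natrM; lra.
have lt_TF : (#|T| + 2 < #|F|)%N by lia.
pose q i : R := if i \in T then 0 else (w i ^+ 4)^-1.
have q_ge0 i : 0 <= q i.
  by rewrite /q; case: ifP => // _; rewrite invr_ge0 exprn_ge0 // ltW.
(* Half the gradient of the potential at fixed barrier. *)
pose c : 'rV[R]_n := \row_j \sum_i (j \in A i)%:R / w i ^+ 3.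
have [u [[u1 supp_u] [u0 xu0] Tu cu qu]] := free_direction A x c lt_TF q_ge0.
pose z i := \sum_(j in A i) u 0 j.
have zw_le0 : \sum_i z i / w i ^+ 3 <= 0.
  apply: le_trans cu; rewrite le_eqVlt; apply/orP; left; apply/eqP.
  under [RHS]eq_bigr do rewrite mxE mulr_suml.
  rewrite exchange_big /=; apply: eq_bigr => i _.
  rewrite /z mulr_suml big_mkcond; apply: eq_bigr => j _ /=.
  by case: (j \in A i); rewrite ?mul0r // mul1r mulrC.
have W3_gt0 : 0 < \sum_i (w i ^+ 3)^-1.
  rewrite (bigD1 (Ordinal m_gt0)) //=; apply: ltr_pwDl.
    by rewrite invr_gt0 exprn_gt0.
  by apply: sumr_ge0 => i _; rewrite invr_ge0 exprn_ge0 // ltW.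
(* Outside [T] the slack is at least [9 / 4 * sqrt #|F|], hence at least [9 / 4 * a]. *)
have q_le i : q i <= 4 / 9 / a * (w i ^+ 3)^-1.
  have w3_ge0 : 0 <= (w i ^+ 3)^-1 by rewrite invr_ge0 exprn_ge0 // ltW.
  have a_ge0 : 0 <= 4 / 9 / a by rewrite divr_ge0 // ?ltW //; lra.
  rewrite /q; case: ifPn => [_|]; first exact: mulr_ge0.
  rewrite inE -leNgt => le_w.
  have -> : (w i ^+ 4)^-1 = (w i)^-1 * (w i ^+ 3)^-1.
    by field; rewrite gt_eqF.
  apply: ler_wpM2r => //.
  rewrite -ler_sqr ?nnegrE ?invr_ge0 ?(ltW (w_gt0 i)) // exprVn.
  apply: le_trans le_w _; rewrite !expr_div_n sqr_a.
  have -> : 4 ^+ 2 / 9 ^+ 2 / energy x = 16 / 81 / energy x :> R.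
    by field; rewrite gt_eqF.
  by apply: ler_wpM2l; [lra | rewrite lef_pV2 ?posrE].
have z2_le : \sum_i z i ^+ 2 / w i ^+ 4 <= 3 * \sum_i q i.
  have d_gt0 : 0 < (#|F| - (#|T| + 2))%:R :> R by rewrite ltr0n subn_gt0.
  (* At least a third of the dimensions remain; equality occurs for [#|F| = 3] and [T] empty. *)
  have F_le3 : #|F|%:R <= 3 * (#|F| - (#|T| + 2))%:R :> R.
    by rewrite -natrM ler_nat; lia.
  rewrite -(ler_pM2l d_gt0).
  have -> : \sum_i z i ^+ 2 / w i ^+ 4 = \sum_i q i * z i ^+ 2.
    apply: eq_bigr => i _; rewrite mulrC /q; case: ifPn => // Ti.
    by rewrite /z Tu // expr0n /= !mulr0.
  apply: le_trans qu _; rewrite mulrCA mulrA.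
  by apply: ler_wpM2r; first exact: sumr_ge0.
(* In units of the cubic sum divided by [a], the left side is at most [3 * 3 * 4 / 9 = 4] and the
   right side is [9 / 2]. *)
have z2_lt : 3 * \sum_i z i ^+ 2 / w i ^+ 4 <
    2 * (9 / 4 / a) * \sum_i (w i ^+ 3)^-1.
  have : \sum_i q i <= 4 / 9 / a * \sum_i (w i ^+ 3)^-1.
    by rewrite mulr_sumr; apply: ler_sum.
  have : 0 < a^-1 * \sum_i (w i ^+ 3)^-1 by rewrite mulr_gt0 ?invr_gt0.
  rewrite -!mulrA; lra.
apply: (feasible_step Fx u1 u0 xu0).
  by move=> j x_ge1; apply: supp_u; rewrite inE -leNgt.
have := potential_step w_gt0 zw_le0 z2_lt.
apply: filterS => e [w'_gt0 Phi'_le]; rewrite (energy_step _ u1 xu0) => E_ge0.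
exists (fun i => w i + 9 / 4 / a * e ^+ 2 - e * z i) => // i.
rewrite w'_gt0 /= /w /slack (energy_step _ u1 xu0).
have -> : \sum_(j in A i) (x + e *: u) 0 j = \sum_(j in A i) x 0 j + e * z i.
  by under eq_bigr do rewrite !mxE; rewrite big_split /= -mulr_sumr.
have E_le_m : energy x <= (m + 2)%:R by rewrite (le_trans E_le) // ler_nat.
have le_eE : e ^+ 2 <= energy x by rewrite -subr_ge0.
have := barrier_gain E_gt0 E_le_m le_eE.
rewrite -/a; lra.
Qed.

Lemma feasible_few_free (R : realType) (m n : nat) (A : 'I_m -> {set 'I_n}) :
  (0 < m)%N -> exists2 x : 'rV[R]_n, feasible A x & (#|free_coords x| <= 2)%N.
Proof.
move=> m_gt0; have [x Fx x_min] := feasible_min_energy R A m_gt0.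
exists x => //; rewrite leqNgt; apply/negP => F_gt2.
suff [y Fy] : exists2 y, feasible A y & energy y < energy x.
  by rewrite ltNge x_min.
have [F_le|F_gt] := leqP #|free_coords x| (m + 2).
  by apply: energy_descent_few => //; rewrite F_gt2.
exact: energy_descent_many.
Qed.

(** * Rounding to a set of low discrepancy *)

Lemma sum_sign_mem (R : pzRingType) (T : finType) (v B : {set T}) :
  \sum_(j in B) (if j \in v then 1 else -1) =
  (2 * #|v :&: B|)%:R - #|B|%:R :> R.
Proof.
rewrite finset.setIC -(cardsID v B) natrD natrM (big_setID v) /=.
rewrite (eq_bigr (fun=> 1)) => [|j]; last by rewrite inE => /andP[_ ->].
rewrite [X in _ + X](eq_bigr (fun=> -1)) => [|j]; last first.
  by rewrite inE => /andP[/negbTE ->].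
rewrite !sumr_const mulNrn mulr_natl mulr2n.
by rewrite opprD addrA addrK.
Qed.

(** Of the at most two free coordinates one is rounded up ([J]) and the other down. Rounding up adds
    at most 2 to any set sum. Rounding down takes strictly less than 2 from the total 0, and parity
    turns this into [n <= 2 * #|v|]. *)
Lemma low_discrepancy_set (R : realType) (m n : nat) (A : 'I_m -> {set 'I_n}) :
  ~~ odd n -> (0 < m)%N ->
  exists2 v : {set 'I_n}, (n <= 2 * #|v|)%N &
    forall i, (2 * #|v :&: A i|)%:R - #|A i|%:R <= 9 * Num.sqrt m%:R + 2 :> R.
Proof.
move=> n_even m_gt0; have [x Fx F_le2] := feasible_few_free R A m_gt0.
have [x_le1 sum_x _] := Fx.
have x_bound j : -1 <= x 0 j <= 1.
  by have := x_le1 j => ?; apply/andP; split; nra.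
set F := free_coords x in F_le2.
have [J [sJF J_le1 FJ_le1]] :
    exists J : {set 'I_n},
      [/\ J \subset F, (#|J| <= 1)%N & (#|F :\: J| <= 1)%N].
  have [->|[j0 Fj0]] := set_0Vmem F.
    by exists finset.set0; rewrite finset.sub0set finset.setD0 cards0.
  exists [set j0]%SET; rewrite finset.sub1set cards1 Fj0; split=> //.
  by move: F_le2; rewrite (cardsD1 j0) Fj0.
pose v := ([set j | x 0 j == 1] :|: J)%SET.
pose sg j : R := if j \in v then 1 else -1.
have sg_le j : sg j <= x 0 j + 2 * (j \in J)%:R.
  have := x_bound j; rewrite /sg !inE => /andP[x_ge x_le].
  by case: eqP => [->|_]; case: (j \in J) => /=; lra.
have sg_ge j : j \notin F :\: J -> x 0 j <= sg j.
  have := x_bound j; rewrite /sg !inE => /andP[x_ge x_le].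
  case: (j \in J) => /=; first by rewrite orbT.
  rewrite orbF -leNgt => x2_ge1; case: eqP => [->//|x_neq1].
  suff : x 0 j = -1 by move->.
  by nra.
exists v.
  have sum_sg : -2 < \sum_j sg j :> R.
    suff : -2 < \sum_j (sg j - x 0 j) by rewrite sumrB sum_x subr0.
    rewrite (bigID (mem (F :\: J)%SET)) /=.
    have rest_ge0 : 0 <= \sum_(j | j \notin (F :\: J)%SET) (sg j - x 0 j).
      by apply: sumr_ge0 => j /sg_ge; rewrite subr_ge0.
    suff : -2 < \sum_(j in (F :\: J)%SET) (sg j - x 0 j) by lra.
    have := FJ_le1; rewrite leq_eqVlt ltnS leqn0 cards_eq0.
    case/orP=> [/cards1P[j1 FJE]|/eqP ->]; last by rewrite big_set0; lra.
    have : j1 \in (F :\: J)%SET by rewrite FJE set11.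
    rewrite finset.in_setD inE => /andP[_ xj1]; rewrite FJE big_set1 /sg.
    by case: ifP => _; nra.
  have := sum_sign_mem R v [set: 'I_n]%SET.
  rewrite finset.setIT cardsT card_ord (eq_bigl predT) => [|j]; last first.
    by rewrite finset.in_setT.
  rewrite -/(\sum_j sg j) => sum_sgE; rewrite sum_sgE in sum_sg.
  have : (n < 2 * #|v| + 2)%N by rewrite -(ltr_nat R) natrD; lra.
  have := odd_double_half n.
  rewrite (negbTE n_even) -mul2n add0n => n_half n_lt.
  suff -> : (n <= 2 * #|v|)%N by [].
  by lia.
move=> i; rewrite -sum_sign_mem -/sg.
apply: (@le_trans _ _ (\sum_(j in A i) x 0 j + 2)).
  apply: le_trans (ler_sum _ (fun j _ => sg_le j)) _.
  rewrite big_split /= lerD2l -mulr_sumr -[leRHS]mulr1 ler_wpM2l // -natr_sum.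
  rewrite -(ler_nat R) in J_le1; apply: le_trans J_le1.
  rewrite ler_nat -sum1_card big_mkcond [leqRHS]big_mkcond.
  by apply: leq_sum => j _; case: (j \in A i); case: (j \in J).
(* The slack [9 / 2] pays exactly for replacing [sqrt (m + 2)] by [sqrt m + 1] in the barrier,
   leaving [9 * sqrt m]. *)
have slack_i := slack_ge i Fx; rewrite lerD2r.
have sqrt_m2 : Num.sqrt (m + 2)%:R <= Num.sqrt m%:R + 1 :> R.
  rewrite -(ler_sqr (sqrtr_ge0 _)) ?nnegrE ?addr_ge0 ?sqrtr_ge0 //.
  rewrite sqrrD1 !sqr_sqrtr ?ler0n // natrD -addrA lerD2l.
  have : 1 <= Num.sqrt m%:R :> R by rewrite -[leLHS]sqrtr1 ler_wsqrtr // ler1n.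
  lra.
have barrier_le : barrier m (energy x) <=
    9 / 2 * (Num.sqrt m%:R + Num.sqrt (m + 2)%:R).
  apply: ler_wpM2l; first lra.
  by rewrite lerD2l ge_max sqrtr_ge0 gerBl sqrtr_ge0.
rewrite /slack in slack_i; lra.
Qed.

(** * From discrepancy to colorings *)

Lemma subset_of_card (T : finType) (v : {set T}) (k : nat) :
  (k <= #|v|)%N -> exists2 w : {set T}, w \subset v & #|w| = k.
Proof.
move=> le_kv; exists [set z in take k (enum v)]%SET.
  by apply/fintype.subsetP => z; rewrite inE => /mem_take; rewrite mem_enum.
rewrite cardsE; apply: etrans (card_uniqP _) _.
  by rewrite take_uniq // enum_uniq.
by rewrite size_takel // -cardE.
Qed.

(** A [k]-subset [w] of the low-discrepancy set [v] lies in the Frankl set of its own color.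
    Enlarging [w] to [v] keeps the Frankl inequality, which bounds [s] by the discrepancy. *)
Lemma F_colorable_lower_bound (n k s m : nat) :
  ~~ odd n -> (k <= n./2)%N -> F_colorable n k s m -> (s ^ 2 <= 144 * m)%N.
Proof.
move=> n_even le_k /existsP[f /andP[_ /forallP f_frankl]].
have n_half : (2 * n./2 = n)%N.
  by rewrite -[RHS]odd_double_half (negbTE n_even) -mul2n.
have m_gt0 : (0 < m)%N.
  have [w _ w_card] :
      exists2 w : {set 'I_n}, w \subset [set: 'I_n]%SET & #|w| = k.
    by apply: subset_of_card; rewrite cardsT card_ord; lia.
  exact: leq_ltn_trans (ltn_ord (f (exist _ w (introT eqP w_card)))).
have /fin_all_exists[A A_frankl] : forall c, exists A : {set 'I_n},
    color_class f c \subset frankl_set k s A.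
  move=> c.
  have /existsP[G /andP[/existsP[A /andP[_ /eqP ->]] sub]] := f_frankl c.
  by exists A.
have [v v_card v_disc] := low_discrepancy_set Rdefinitions.R A n_even m_gt0.
have [|w sub_wv w_card] := @subset_of_card _ v k; first by lia.
pose w' : ksubset n k := exist _ w (introT eqP w_card).
have w'_frankl : w' \in frankl_set k s (A (f w')).
  by apply: (fintype.subsetP (A_frankl _)); rewrite inE.
have s_le : (#|A (f w')| + s <= 2 * #|v :&: A (f w')|)%N.
  move: w'_frankl; rewrite inE => /leq_trans; apply.
  by rewrite leq_mul2l subset_leq_card ?orbT // finset.setSI.
have := v_disc (f w'); move: s_le; rewrite -(ler_nat Rdefinitions.R) natrD.
set a := Num.sqrt _ => s_le disc_le.
have m_ge1 : 1 <= m%:R :> Rdefinitions.R by rewrite ler1n.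
have a_ge0 : 0 <= a by exact: sqrtr_ge0.
have sqr_a : a ^+ 2 = m%:R by rewrite sqr_sqrtr.
have s_ge0 : 0 <= s%:R :> Rdefinitions.R by [].
rewrite -(ler_nat Rdefinitions.R) natrX natrM -sqr_a.
(* This absorbs the rounding loss: [s <= 9 * a + 2 <= 11 * a]. *)
have a_ge1 : 1 <= a by nra.
by nra.
Qed.

Theorem theorem5 (n t s : nat) (n_even : ~~ odd n) (t_le : (t <= n./2)%N)
    (s_le : (s <= n./2 - t)%N) :
  (((F_chromatic_number n s_le)%:R : rat) >= 1 / 144%:R * s%:R ^+ 2)%R.
Proof.
rewrite /F_chromatic_number; case: ex_minnP => m colorable_m _.
have := F_colorable_lower_bound n_even (leq_subr _ _) colorable_m.
rewrite -(ler_nat rat) natrX natrM; lra.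
Qed.
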